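(* Let $(M,d)$ be a metric space, let $f\colon M\to M$ be a Lipschitz map with $f(0_M)=0_M$ for a distinguished point $0_M\in M$, and let $T\colon X\to X$ be a linearization of $f$ on a complete (Hausdorff) real locally convex space $X$ such that the associated injection $j\colon M\to X$ is seminorm-Lipschitz. Then $T$ is quasi-conjugate to the induced Lipschitz-free operator $T_f$ on $\mathcal F(M)$, that is, there exists a continuous map $\phi\colon\mathcal F(M)\to X$ with dense range such that $T\circ\phi=\phi\circ T_f$.
   Context: An operator on a topological vector space is a continuous linear self-map. Linearization: given a continuous map $f\colon W\to W$ on a topological space $W$ with a fixed point $0_W$, a continuous injection $j\colon W\to X$ into a topological vector space $X$, and an operator $T\colon X\to X$, one says that $(X,T)$ is a linearization of $(W,f)$ if $T\circ j=j\circ f$, $j(0_W)=0$, and $\operatorname{span}(j(W))$ is dense in $X$. Here $W=M$ and $0_W=0_M$. A map $h\colon M\to X$ from a metric space $(M,d)$ into a locally convex space $X$ is seminorm-Lipschitz if for every continuous seminorm $p$ on $X$ there is $c_p>0$ such that $p(h(x)-h(y))\le c_p\,d(x,y)$ for all $x,y\in M$. Quasi-conjugacy: for continuous maps $S\colon Y\to Y$ and $T\colon X\to X$ on topological spaces, $T$ is quasi-conjugate to $S$ if there is a continuous map $\phi\colon Y\to X$ with dense range such that $T\circ\phi=\phi\circ S$. For a metric space $(M,d)$ with distinguished point $0_M$, $\mathrm{Lip}_0(M)$ is the real Banach space of Lipschitz functions $g\colon M\to\mathbb R$ with $g(0_M)=0$, normed by the Lipschitz constant; $\delta_x\in\mathrm{Lip}_0(M)^*$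 is evaluation at $x\in M$; the Lipschitz-free space is $\mathcal F(M)=\overline{\operatorname{span}}\{\delta_x:x\in M\}\subset\mathrm{Lip}_0(M)^*$. $T_f\colon\mathcal F(M)\to\mathcal F(M)$ is the unique bounded linear operator with $T_f(\delta_x)=\delta_{f(x)}$ for all $x\in M$. *)

(* Defs.v *)
From HB Require Import structures.
From mathcomp Require Import all_boot all_order all_algebra.
From mathcomp Require Import all_classical all_reals all_analysis.

Set Implicit Arguments.
Unset Strict Implicit.
Unset Printing Implicit Defensive.

Import Order.TTheory GRing.Theory Num.Theory.
Import numFieldNormedType.Exports.

Local Open Scope classical_set_scope.
Local Open Scope ring_scope.

Definition is_lipschitz {R : realType} {M N : metricType R} (f : M -> N) :=
  exists k : R, forall x y, mdist (f x) (f y) <= k * mdist x y.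

Definition lspan {R : realType} {V : lmodType R} (A : set V) : set V :=
  [set v | exists (n : nat) (a : 'I_n -> R) (x : 'I_n -> V),
     (forall i, A (x i)) /\ v = \sum_(i < n) a i *: x i].

Definition is_seminorm {R : realType} {V : lmodType R} (p : V -> R) :=
  [/\ forall x, 0 <= p x,
      forall x y, p (x + y) <= p x + p y
    & forall (a : R) x, p (a *: x) = `|a| * p x].

(* Completeness for the translation-invariant uniformity.  The entourages
   carried by a [tvsType] are only required to be compatible with its topology,
   so [cauchy] cannot be used here. *)
Definition tvs_cauchy {R : realType} {X : topologicalLmodType R}
    (F : set_system X) :=
  forall U : set X, nbhs 0 U ->
    exists2 A, F A & forall x y, A x -> A y -> U (x - y).

Definition tvs_complete {R : realType} (X : topologicalLmodType R) :=
  forall F : set_system X, ProperFilter F -> tvs_cauchy F ->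
    exists x : X, F --> x.

Definition is_operator {R : realType} {X : topologicalLmodType R}
    (T : X -> X) := linear T /\ continuous T.

Definition seminorm_lipschitz {R : realType} {M : metricType R}
    {X : topologicalLmodType R} (h : M -> X) :=
  forall p : X -> R, is_seminorm p -> continuous p ->
    exists2 c : R, 0 < c & forall x y, p (h x - h y) <= c * mdist x y.

Definition is_linearization {R : realType} {W : topologicalType} (o : W)
    (f : W -> W) {X : topologicalLmodType R} (T : X -> X) (j : W -> X) :=
  [/\ is_operator T,
      continuous j /\ injective j,
      T \o j = j \o f,
      j o = 0
    & dense (lspan (range j))].

Definition quasi_conjugate {X Y : topologicalType} (T : X -> X) (S : Y -> Y) :=
  exists phi : Y -> X,
    [/\ continuous phi, dense (range phi) & T \o phi = phi \o S].

Section Lip0.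
Context {R : realType} {M : metricType R} (o : M).
Implicit Types g h : M -> R^o.

Definition lip0_pred : {pred M -> R^o} :=
  mem [set g : M -> R^o | is_lipschitz g /\ g o = 0].

Record lip0 := Lip0 { lip0_fun :> M -> R^o ; _ : lip0_fun \in lip0_pred }.

HB.instance Definition _ := [isSub for lip0_fun].
HB.instance Definition _ := [Choice of lip0 by <:].

Lemma lip0_predP g : reflect
  ((exists k, forall x y, `|g x - g y| <= k * mdist x y) /\ g o = 0)
  (g \in lip0_pred).
Proof.
apply: (iffP idP).
  move=> /set_mem[[k gk] go]; split=> //; exists k => x y.
  by rewrite distrC; exact: gk.
by case=> -[k gk] go; apply/mem_set; split=> //; exists k => x y;
  rewrite /mdist/= distrC.
Qed.

Lemma lip0_submod_closed : submod_closed lip0_pred.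
Proof.
split.
  apply/lip0_predP; split=> //; exists 0 => x y.
  by rewrite /= subrr normr0 mul0r.
move=> a g h /lip0_predP[[k gk] go] /lip0_predP[[l hl] ho].
apply/lip0_predP; split.
  exists (`|a| * k + l) => x y /=.
  have -> : (a *: g + h) x - (a *: g + h) y = a * (g x - g y) + (h x - h y).
    by rewrite mulrBr addrACA -opprD.
  rewrite (le_trans (ler_normD _ _))// mulrDl lerD// normrM -mulrA.
  by rewrite ler_wpM2l.
by rewrite /= -[LHS]/(a * g o + h o) go ho mulr0 addr0.
Qed.

HB.instance Definition _ :=
  GRing.isSubmodClosed.Build R (M -> R^o) lip0_pred lip0_submod_closed.
HB.instance Definition _ := [SubChoice_isSubLmodule of lip0 by <:].

Definition slopes (g : M -> R) : set R :=
  [set s | exists x y : M, x <> y /\ s = `|g x - g y| / mdist x y].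

Definition lip0_norm (g : lip0) : R := sup (slopes g).

Lemma lip0_fun0 (g : lip0) : g o = 0.
Proof. by case: g => g gP; case/lip0_predP: (gP). Qed.

Lemma lip0_funP (g : lip0) :
  exists k, forall x y, `|g x - g y| <= k * mdist x y.
Proof. by case: g => g gP; case/lip0_predP: (gP). Qed.

Lemma lip0_normP (g : lip0) x y : `|g x - g y| <= lip0_norm g * mdist x y.
Proof.
have [->|/eqP xy] := eqVneq x y; first by rewrite subrr normr0 mdistxx mulr0.
have xy0 : 0 < mdist x y by rewrite mdist_gt0; exact/eqP.
rewrite -ler_pdivrMr//; apply: ub_le_sup; last by exists x, y.
have [k gk] := lip0_funP g.
exists k => _ [u [v [uv ->]]]; rewrite ler_pdivrMr//.
by rewrite mdist_gt0; exact/eqP.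
Qed.

Lemma lip0_norm_le (g : lip0) k : 0 <= k ->
  (forall x y, `|g x - g y| <= k * mdist x y) -> lip0_norm g <= k.
Proof.
move=> k0 gk; rewrite /lip0_norm.
have [->|/set0P ne] := eqVneq (slopes g) set0; first by rewrite sup0.
apply: ge_sup => // _ [u [v [uv ->]]]; rewrite ler_pdivrMr//.
by rewrite mdist_gt0; exact/eqP.
Qed.

Lemma lip0_norm_ge0 (g : lip0) : 0 <= lip0_norm g.
Proof.
rewrite /lip0_norm.
have [->|/set0P[s gs]] := eqVneq (slopes g) set0; first by rewrite sup0.
have s0 : 0 <= s by case: gs => x [y [_ ->]]; rewrite divr_ge0// mdist_ge0.
apply: (le_trans s0); apply: ub_le_sup => //.
have [k gk] := lip0_funP g.
exists k => _ [u [v [uv ->]]]; rewrite ler_pdivrMr//.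
by rewrite mdist_gt0; exact/eqP.
Qed.

Lemma lip0_normD (g h : lip0) : lip0_norm (g + h) <= lip0_norm g + lip0_norm h.
Proof.
apply: lip0_norm_le => [|x y]; first by rewrite addr_ge0// lip0_norm_ge0.
have -> : (g + h) x - (g + h) y = (g x - g y) + (h x - h y).
  by rewrite addrACA -opprD.
by rewrite mulrDl (le_trans (ler_normD _ _))// lerD// lip0_normP.
Qed.

Let lip0_normZ_le a (g : lip0) : lip0_norm (a *: g) <= `|a| * lip0_norm g.
Proof.
apply: lip0_norm_le => [|x y]; first by rewrite mulr_ge0// lip0_norm_ge0.
have -> : (a *: g) x - (a *: g) y = a * (g x - g y) by rewrite mulrBr.
by rewrite normrM -mulrA ler_wpM2l// lip0_normP.
Qed.

Lemma lip0_normZ a (g : lip0) : lip0_norm (a *: g) = `|a| * lip0_norm g.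
Proof.
apply/eqP; rewrite eq_le lip0_normZ_le/=.
have [->|a0] := eqVneq a 0; first by rewrite normr0 mul0r lip0_norm_ge0.
rewrite -ler_pdivlMl ?normr_gt0// -normfV -{1}(scalerK a0 g).
exact: lip0_normZ_le.
Qed.

Lemma lip0_norm0_eq0 (g : lip0) : lip0_norm g = 0 -> g = 0.
Proof.
move=> g0; apply/val_inj/funext => x /=.
have := lip0_normP g x o; rewrite g0 mul0r lip0_fun0 subr0 normr_le0.
by move=> /eqP.
Qed.

HB.instance Definition _ := Lmodule_isNormed.Build R lip0
  lip0_normD lip0_normZ lip0_norm0_eq0.

End Lip0.

Section Dual.
Context {R : realType} (V : normedModType R).

Definition dual_pred : {pred V -> R^o} :=
  mem [set l : V -> R^o | linear l /\ continuous l].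

Record dual := Dual { dual_fun :> V -> R^o ; _ : dual_fun \in dual_pred }.

HB.instance Definition _ := [isSub for dual_fun].
HB.instance Definition _ := [Choice of dual by <:].

Lemma dual_submod_closed : submod_closed dual_pred.
Proof.
split.
  apply/mem_set; split; last exact: cst_continuous.
  by move=> a u v /=; rewrite scaler0 addr0.
move=> a k l /set_mem[klin kc] /set_mem[llin lc]; apply/mem_set; split.
  move=> b u v.
  rewrite -[LHS]/(a *: k (b *: u + v) + l (b *: u + v)) klin llin.
  rewrite -[RHS]/(b *: (a *: k u + l u) + (a *: k v + l v)).
  by rewrite !scalerDr !scalerA (mulrC a b) addrACA.
by move=> x; apply: continuousD; [apply: continuousZr; exact: kc|exact: lc].
Qed.

HB.instance Definition _ :=
  GRing.isSubmodClosed.Build R (V -> R^o) dual_pred dual_submod_closed.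
HB.instance Definition _ := [SubChoice_isSubLmodule of dual by <:].

Definition dual_norm (l : dual) : R :=
  sup [set `|l v| | v in [set v : V | `|v| <= 1]].

Lemma dual_linear (l : dual) : linear l.
Proof. by case: l => l /=/set_mem[]. Qed.

Lemma dual_continuous (l : dual) : continuous l.
Proof. by case: l => l /=/set_mem[]. Qed.

HB.instance Definition _ (l : dual) :=
  GRing.isLinear.Build R V R^o *:%R l (@dual_linear l).

Lemma dual_bounded (l : dual) : exists2 k, 0 <= k &
  forall v, `|l v| <= k * `|v|.
Proof.
have /linear_boundedP/pinfty_ex_gt0[k k0 lk] :=
  (@linear_bounded_continuous _ _ _ (l : {linear V -> R^o})).2
    (@dual_continuous l).
by exists k => //; exact: ltW.
Qed.

Let dual_set_ub (l : dual) :
  has_ubound [set `|l v| | v in [set v : V | `|v| <= 1]].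
Proof.
have [k k0 lk] := dual_bounded l.
by exists k => _ [v /= v1 <-]; rewrite (le_trans (lk v))// ler_piMr.
Qed.

Lemma dual_norm_ge0 (l : dual) : 0 <= dual_norm l.
Proof.
apply: (@le_trans _ _ `|l 0|) => //; apply: ub_le_sup => //.
by exists 0 => //=; rewrite normr0.
Qed.

Lemma dual_normP (l : dual) v : `|l v| <= dual_norm l * `|v|.
Proof.
have [->|v0] := eqVneq v 0; first by rewrite linear0 !normr0 mulr0.
have nv0 : 0 < `|v| by rewrite normr_gt0.
rewrite -ler_pdivrMr//; apply: ub_le_sup => //.
exists (`|v|^-1 *: v) => /=.
  by rewrite normrZ normfV normr_id mulVf ?gt_eqF.
by rewrite linearZ/= normrM normfV normr_id mulrC.
Qed.

Lemma dual_norm_le (l : dual) k : 0 <= k ->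
  (forall v, `|l v| <= k * `|v|) -> dual_norm l <= k.
Proof.
move=> k0 lk; apply: ge_sup.
  by exists `|l 0|, 0 => //=; rewrite normr0.
by move=> _ [v /= v1 <-]; rewrite (le_trans (lk v))// ler_piMr.
Qed.

Lemma dual_normD (k l : dual) : dual_norm (k + l) <= dual_norm k + dual_norm l.
Proof.
apply: dual_norm_le => [|v]; first by rewrite addr_ge0// dual_norm_ge0.
by rewrite mulrDl (le_trans (ler_normD _ _))// lerD// dual_normP.
Qed.

Let dual_normZ_le a (l : dual) : dual_norm (a *: l) <= `|a| * dual_norm l.
Proof.
apply: dual_norm_le => [|v]; first by rewrite mulr_ge0// dual_norm_ge0.
rewrite -[X in `|X|]/(a * l v).
by rewrite normrM -mulrA ler_wpM2l// dual_normP.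
Qed.

Lemma dual_normZ a (l : dual) : dual_norm (a *: l) = `|a| * dual_norm l.
Proof.
apply/eqP; rewrite eq_le dual_normZ_le/=.
have [->|a0] := eqVneq a 0; first by rewrite normr0 mul0r dual_norm_ge0.
rewrite -ler_pdivlMl ?normr_gt0// -normfV -{1}(scalerK a0 l).
exact: dual_normZ_le.
Qed.

Lemma dual_norm0_eq0 (l : dual) : dual_norm l = 0 -> l = 0.
Proof.
move=> l0; apply/val_inj/funext => v /=.
by have := dual_normP l v; rewrite l0 mul0r normr_le0 => /eqP.
Qed.

HB.instance Definition _ := Lmodule_isNormed.Build R dual
  dual_normD dual_normZ dual_norm0_eq0.

End Dual.
Arguments dual_pred {R} V.

Section LipFree.
Context {R : realType} {M : metricType R} (o : M).
Local Notation D := (dual (lip0 o)).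

Definition eval_fun (x : M) (g : lip0 o) : R^o := g x.

Lemma eval_fun_dual x : eval_fun x \in dual_pred (lip0 o).
Proof.
have evlin : linear (eval_fun x) by move=> a g h.
pose L := GRing.isLinear.Build R (lip0 o) R^o *:%R (eval_fun x) evlin.
pose ev : {linear lip0 o -> R^o} := HB.pack (eval_fun x) L.
apply/mem_set; split=> //.
apply: (@bounded_linear_continuous _ _ _ ev); apply/linear_boundedP.
exists (mdist x o); split; first exact: num_real.
move=> r xr g; rewrite -[ev g]subr0 -(lip0_fun0 g) -/(eval_fun x g).
by rewrite (le_trans (lip0_normP g x o))// mulrC ler_wpM2r ?lip0_norm_ge0// ltW.
Qed.

Definition delta_dual (x : M) : D := Dual (eval_fun_dual x).

Definition lip_free_pred : {pred D} :=
  mem (closure (lspan (range delta_dual))).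

Record lip_free := LipFree {
  lip_free_dual :> D ; _ : lip_free_dual \in lip_free_pred }.

HB.instance Definition _ := [isSub for lip_free_dual].
HB.instance Definition _ := [Choice of lip_free by <:].

Lemma lspan_submod {V : lmodType R} (A : set V) a u v :
  lspan A u -> lspan A v -> lspan A (a *: u + v).
Proof.
move=> [m [b [x [Ax ->]]]] [n [c [y [Ay ->]]]].
exists (m + n)%N, (fun i => match fintype.split i with inl k => a * b k | inr k => c k end),
  (fun i => match fintype.split i with inl k => x k | inr k => y k end); split.
  by move=> i; case: fintype.split.
rewrite big_split_ord/= scaler_sumr; congr (_ + _); apply: eq_bigr => i _.
  by rewrite (unsplitK (inl i)) scalerA.
by rewrite (unsplitK (inr i)).
Qed.

Lemma lspan_sub {V : lmodType R} (A : set V) : A `<=` lspan A.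
Proof.
move=> v Av; exists 1%N, (fun=> 1), (fun=> v); split=> //.
by rewrite big_ord1 scale1r.
Qed.

Lemma closure_normP {V : normedModType R} (A : set V) v :
  closure A v <-> forall e : R, 0 < e -> exists2 u, A u & `|v - u| < e.
Proof.
split=> [Av e e0|Av B /nbhs_ballP[e /= e0 eB]].
  have [u [Au]] := Av _ (nbhsx_ballx v _ e0).
  by rewrite -ball_normE/= => vu; exists u.
have [u Au vu] := Av e e0; exists u; split=> //.
by apply: eB; rewrite -ball_normE.
Qed.

Lemma lip_free_submod_closed : submod_closed lip_free_pred.
Proof.
split.
  apply/mem_set/subset_closure; exists 0%N, (fun=> 0), (fun=> 0).
  by split; [case|rewrite big_ord0].
move=> a u v /set_mem/closure_normP Au /set_mem/closure_normP Av.
apply/mem_set/closure_normP => e e0.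
have k0 : 0 < `|a| + 1 by rewrite ltr_pwDr.
have [u' Au' uu'] := Au (e / (2 * (`|a| + 1))) ltac:(by rewrite divr_gt0// mulr_gt0).
have [v' Av' vv'] := Av (e / 2) ltac:(by rewrite divr_gt0).
exists (a *: u' + v'); first exact: lspan_submod.
rewrite opprD addrACA -scalerBr (le_lt_trans (ler_normD _ _))//.
rewrite (splitr e) ler_ltD// normrZ.
rewrite (@le_trans _ _ ((`|a| + 1) * `|u - u'|))//.
  by rewrite ler_wpM2r// lerDl.
by rewrite -ler_pdivlMl// mulrC -mulrA -invfM ltW.
Qed.

HB.instance Definition _ :=
  GRing.isSubmodClosed.Build R D lip_free_pred lip_free_submod_closed.
HB.instance Definition _ := [SubChoice_isSubLmodule of lip_free by <:].

Definition lip_free_norm (m : lip_free) : R := `|lip_free_dual m|.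

Lemma lip_free_normD m n :
  lip_free_norm (m + n) <= lip_free_norm m + lip_free_norm n.
Proof. exact: ler_normD. Qed.

Lemma lip_free_normZ a m : lip_free_norm (a *: m) = `|a| * lip_free_norm m.
Proof. exact: normrZ. Qed.

Lemma lip_free_norm0_eq0 m : lip_free_norm m = 0 -> m = 0.
Proof. by move=> /normr0_eq0 m0; apply/val_inj. Qed.

HB.instance Definition _ := Lmodule_isNormed.Build R lip_free
  lip_free_normD lip_free_normZ lip_free_norm0_eq0.

Lemma delta_lip_free x : delta_dual x \in lip_free_pred.
Proof. by apply/mem_set/subset_closure/lspan_sub; exists x. Qed.

Definition delta (x : M) : lip_free := LipFree (delta_lip_free x).

Lemma deltaE x (g : lip0 o) : delta x g = g x. Proof. by []. Qed.

Definition is_lip_free_op (f : M -> M) (S : lip_free -> lip_free) :=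
  [/\ linear S, continuous S & forall x, S (delta x) = delta (f x)].

(* The definite description is meaningful when [f] is Lipschitz and fixes [o]:
   see [lip_free_opP] and [lip_free_op_unique]. *)
Definition lip_free_op (f : M -> M) : lip_free -> lip_free :=
  xget (0 : lip_free -> lip_free) [set S : lip_free -> lip_free | is_lip_free_op f S].

Lemma lip_free_dual_sum n (F : 'I_n -> lip_free) :
  lip_free_dual (\sum_(i < n) F i) = \sum_(i < n) lip_free_dual (F i).
Proof. by elim/big_rec2: _ => // i _ m _ <-. Qed.

Lemma lip_free_approx (m : lip_free) (e : R) : 0 < e ->
  exists2 u, lspan (range delta) u & `|m - u| < e.
Proof.
move=> e0; case: (m) => /= l lP.
have /closure_normP/(_ e e0)[_ [n [a [y [Ay ->]]]] lu] := set_mem lP.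
have /fin_all_exists[x xy] : forall i, exists x, delta_dual x = y i.
  by move=> i; have [x _ <-] := Ay i; exists x.
exists (\sum_(i < n) a i *: delta (x i)).
  by exists n, a, (fun i => delta (x i)); split=> // i; exists (x i).
rewrite -[X in X < _]/(`|l - lip_free_dual (\sum_(i < n) a i *: delta (x i))|).
rewrite lip_free_dual_sum (_ : \sum_(i < n) _ = \sum_(i < n) a i *: y i)//.
by apply: eq_bigr => i _; rewrite -xy.
Qed.

Lemma dense_span_delta : dense (lspan (range delta)).
Proof.
move=> O [m Om] Oo.
have /nbhs_ballP[e /= e0 eO] : nbhs m O by exact: open_nbhs_nbhs.
have [u Au mu] := lip_free_approx m e0.
by exists u; split=> //; apply: eO; rewrite -ball_normE.
Qed.

Lemma lip_free_op_unique f S S' :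
  is_lip_free_op f S -> is_lip_free_op f S' -> S = S'.
Proof.
move=> [Slin Sc Sd] [S'lin S'c S'd]; apply/funext => m.
pose L := GRing.isLinear.Build R lip_free lip_free *:%R S Slin.
pose L' := GRing.isLinear.Build R lip_free lip_free *:%R S' S'lin.
pose T : {linear lip_free -> lip_free} := HB.pack S L.
pose T' : {linear lip_free -> lip_free} := HB.pack S' L'.
have TT' u : lspan (range delta) u -> T u = T' u.
  move=> [n [a [x [Ax ->]]]]; rewrite !linear_sum; apply: eq_bigr => i _.
  by rewrite !linearZ; have [y _ <-] := Ax i; congr (_ *: _); rewrite /= Sd S'd.
have /linear_boundedP/pinfty_ex_gt0[k k0 Tk] :=
  (@linear_bounded_continuous _ _ _ T).2 Sc.
have /linear_boundedP/pinfty_ex_gt0[k' k'0 T'k] :=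
  (@linear_bounded_continuous _ _ _ T').2 S'c.
apply/eqP; rewrite -subr_eq0 -normr_le0; apply/ler_addgt0Pr => e e0; rewrite add0r.
have kk : 0 < k + k' by rewrite addr_gt0.
have [u Au mu] := lip_free_approx m (divr_gt0 e0 kk).
have -> : S m - S' m = T (m - u) - T' (m - u).
  by rewrite (linearB T) (linearB T') (TT' u Au) opprB addrA subrK.
rewrite (le_trans (ler_normB _ _))// (le_trans (lerD (Tk _) (T'k _)))//.
by rewrite -mulrDl mulrC -ler_pdivlMr// ltW.
Qed.

Section Existence.
Variables (f : M -> M) (k : R).
Hypotheses (k0 : 0 <= k) (fo : f o = o).
Hypothesis fk : forall x y, mdist (f x) (f y) <= k * mdist x y.

Let comp_lip0 (g : lip0 o) x y :
  `|g (f x) - g (f y)| <= k * lip0_norm g * mdist x y.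
Proof.
rewrite (le_trans (lip0_normP g _ _))// mulrAC mulrC.
by rewrite ler_wpM2r ?lip0_norm_ge0.
Qed.

Let comp_mem (g : lip0 o) : (g \o f : M -> R^o) \in lip0_pred o.
Proof.
apply/lip0_predP; split; last by rewrite /= fo lip0_fun0.
by exists (k * lip0_norm g); exact: comp_lip0.
Qed.

Let comp (g : lip0 o) : lip0 o := Lip0 (comp_mem g).

Let norm_comp g : `|comp g| <= k * `|g|.
Proof. by apply: lip0_norm_le => [|x y]; [rewrite mulr_ge0|exact: comp_lip0]. Qed.

Let adj_fun (l : D) (g : lip0 o) : R^o := l (comp g).

Let adj_linear l : linear (adj_fun l).
Proof.
move=> a g h; rewrite /adj_fun.
by rewrite (_ : comp (a *: g + h) = a *: comp g + comp h) ?linearP//;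
  exact/val_inj.
Qed.

Let adj_le l g : `|adj_fun l g| <= k * `|l| * `|g|.
Proof.
by rewrite (le_trans (dual_normP l _))// mulrAC mulrC ler_wpM2r ?dual_norm_ge0.
Qed.

Let adj_mem l : adj_fun l \in dual_pred (lip0 o).
Proof.
pose L := GRing.isLinear.Build R (lip0 o) R^o *:%R _ (adj_linear l).
pose A : {linear lip0 o -> R^o} := HB.pack (adj_fun l) L.
apply/mem_set; split; first exact: adj_linear.
apply: (@bounded_linear_continuous _ _ _ A); apply/linear_boundedP.
exists (k * `|l|); split; first exact: num_real.
by move=> r lr g; rewrite (le_trans (adj_le l g))// ler_wpM2r// ltW.
Qed.

Let adj l : D := Dual (adj_mem l).

Let adjP a l l' : adj (a *: l + l') = a *: adj l + adj l'.
Proof. exact/val_inj. Qed.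

Let norm_adj l : `|adj l| <= k * `|l|.
Proof. by apply: dual_norm_le => [|v]; [rewrite mulr_ge0|exact: adj_le]. Qed.

Let adjB l l' : adj l - adj l' = adj (l - l').
Proof. exact/val_inj. Qed.

Let adj_sum n (a : 'I_n -> R) (F : 'I_n -> D) :
  adj (\sum_(i < n) a i *: F i) = \sum_(i < n) a i *: adj (F i).
Proof.
have adj0 : adj 0 = 0 by exact/val_inj.
by elim/big_rec2: _ => // i _ m _ <-; rewrite adjP.
Qed.

Let adj_lip_free l : l \in lip_free_pred -> adj l \in lip_free_pred.
Proof.
move=> /set_mem/closure_normP Al; apply/mem_set/closure_normP => e e0.
have k1 : 0 < k + 1 by rewrite ltr_pwDr.
have [_ [n [a [y [Ay ->]]]] lu] := Al _ (divr_gt0 e0 k1).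
exists (adj (\sum_(i < n) a i *: y i)).
  exists n, a, (adj \o y); rewrite adj_sum; split=> // i.
  by rewrite /=; have [x _ <-] := Ay i; exists (f x) => //; exact/val_inj.
rewrite adjB (le_lt_trans (norm_adj _))//.
rewrite (@le_lt_trans _ _ ((k + 1) * `|l - \sum_(i < n) a i *: y i|))//.
  by rewrite ler_wpM2r// lerDl.
by rewrite mulrC -ltr_pdivlMr.
Qed.

Let S (m : lip_free) : lip_free := LipFree (adj_lip_free (valP m)).

Lemma lip_free_op_ex_subproof : exists S, is_lip_free_op f S.
Proof.
have Slin : linear S by move=> a m n; exact/val_inj/adjP.
exists S; split=> //; last by move=> x; do 2 apply: val_inj.
pose L := GRing.isLinear.Build R lip_free lip_free *:%R S Slin.
pose A : {linear lip_free -> lip_free} := HB.pack S L.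
apply: (@bounded_linear_continuous _ _ _ A); apply/linear_boundedP.
exists k; split; first exact: num_real.
by move=> r kr m; rewrite (le_trans (norm_adj m))// ler_wpM2r// ltW.
Qed.

End Existence.

Lemma lip_free_op_ex f : is_lipschitz f -> f o = o ->
  exists S, is_lip_free_op f S.
Proof.
move=> [k fk] fo; apply: (@lip_free_op_ex_subproof f `|k|) => // x y.
by rewrite (le_trans (fk x y))// ler_wpM2r ?mdist_ge0// ler_norm.
Qed.

Lemma lip_free_opP f : is_lipschitz f -> f o = o ->
  is_lip_free_op f (lip_free_op f).
Proof. by move=> fl fo; have [S /(xgetI 0)] := lip_free_op_ex fl fo. Qed.

End LipFree.

Arguments delta {R M} o x.
Arguments is_lip_free_op {R M} o f S.
Arguments lip_free_op {R M} o f _.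

(* Main.v *)
Require Import Defs.
From HB Require Import structures.
From mathcomp Require Import all_boot all_order all_algebra.
From mathcomp Require Import all_classical all_reals all_analysis.

Set Implicit Arguments.
Unset Strict Implicit.
Unset Printing Implicit Defensive.

Import Order.TTheory GRing.Theory Num.Theory.
Import numFieldNormedType.Exports.

Local Open Scope classical_set_scope.
Local Open Scope ring_scope.

(* Let [phi] send [delta x] to [j x] and extend it linearly to the span of the
   evaluations.  For a continuous seminorm [p] with
   [p (j x - j y) <= c * mdist x y] and [l] a linear functional dominated by
   [p], [l \o j] belongs to the [c]-ball of Lip_0; Hahn-Banach therefore gives
   [p (phi u) <= c * `|u|].  Local convexity makes [phi] Cauchy-continuous, so
   it extends to the free space by completeness of [X], and both the
   intertwining relation and the density of the range come from the span. *)

(** * Hahn-Banach theorem *)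

Section HahnBanach.
Context {R : realType} {V : lmodType R}.
Implicit Types p q : V -> R.

Definition sublinear p :=
  (forall x y, p (x + y) <= p x + p y) /\
  (forall t x, 0 <= t -> p (t *: x) = t * p x).

Lemma sublinear0 p : sublinear p -> p 0 = 0.
Proof. by move=> [_ pZ]; rewrite -[0 in LHS](scale0r 0) pZ// mul0r. Qed.

Lemma sublinear_geN p x : sublinear p -> - p (- x) <= p x.
Proof.
by move=> pP; rewrite -subr_ge0 opprK -(sublinear0 pP) -(addrN x) pP.1.
Qed.

(** Using the inequality for [t^-1] at [t *: x] gives the converse inequality. *)
Lemma sublinear_homog_le p :
  p 0 = 0 -> (forall t x, 0 < t -> p (t *: x) <= t * p x) ->
  forall t x, 0 <= t -> p (t *: x) = t * p x.
Proof.
move=> p0 pZ t x; rewrite le_eqVlt => /predU1P[<-|t0].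
  by rewrite scale0r p0 mul0r.
apply/eqP; rewrite eq_le pZ//= -ler_pdivlMl//.
have := pZ t^-1 (t *: x); rewrite invr_gt0 scalerA mulVf ?gt_eqF// scale1r.
exact.
Qed.

(** Supplies lower bounds of chains for Zorn's lemma. The infimum is finite since
    [- p (- x) <= q x]; for subadditivity, the smaller of [q] and [q'] serves at both points. *)
Lemma inf_sublinear (F : set (V -> R)) p : F !=set0 ->
  (forall q, F q -> sublinear q /\ forall x, q x <= p x) ->
  (forall q q', F q -> F q' ->
     (forall x, q x <= q' x) \/ (forall x, q' x <= q x)) ->
  exists2 i, sublinear i & forall q x, F q -> i x <= q x.
Proof.
move=> [q0 Fq0] FP Ftot; pose i x := inf [set q x | q in F].
have iF q x : F q -> i x <= q x.
  move=> Fq; apply: ge_inf; last by exists q.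
  exists (- p (- x)) => _ [r /FP[rP rp] <-].
  by rewrite (le_trans _ (sublinear_geN x rP))// lerN2.
have Fi x c : (forall q, F q -> c <= q x) -> c <= i x.
  move=> cF; apply: lb_le_inf; first by exists (q0 x), q0.
  by move=> _ [q Fq <-]; exact: cF.
have i0 : i 0 = 0.
  apply/eqP; rewrite eq_le Fi ?andbT.
    by have := iF _ 0 Fq0; rewrite (sublinear0 (FP _ Fq0).1).
  by move=> q Fq; rewrite (sublinear0 (FP _ Fq).1).
clearbody i; exists i => //; split=> [x y|]; last first.
  apply: sublinear_homog_le => // t x t0.
  rewrite -ler_pdivrMl//; apply: (Fi) => q Fq; rewrite ler_pdivrMl//.
  by rewrite -(FP _ Fq).1.2 ?(ltW t0)// iF.
rewrite -lerBlDr; apply: (Fi) => q Fq; rewrite lerBlDr [q x + _]addrC -lerBlDr.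
apply: (Fi) => q' Fq'; rewrite lerBlDr [q' y + _]addrC.
have [qq'|q'q] := Ftot _ _ Fq Fq'.
  by rewrite (le_trans (iF _ _ Fq))// (le_trans ((FP _ Fq).1.1 _ _))// lerD2l.
by rewrite (le_trans (iF _ _ Fq'))// (le_trans ((FP _ Fq').1.1 _ _))// lerD2r.
Qed.

(** For sublinear [p], this stays sublinear and below [p], while its value at [- v] drops to at most
    [- p v]. *)
Definition slide p v x :=
  inf [set p (x + t *: v) - t * p v | t in [set t | 0 <= t]].

Section Slide.
Variables (p : V -> R) (v : V).
Hypothesis pP : sublinear p.

Let slide_lb x :
  has_lbound [set p (x + t *: v) - t * p v | t in [set t | 0 <= t]].
Proof.
exists (- p (- x)) => _ [t /= t0 <-].
rewrite lerBrDr -pP.2// addrC lerBlDr.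
by rewrite -[in X in X <= _](addKr x (t *: v)) addrC pP.1.
Qed.

Lemma slide_le t x : 0 <= t -> slide p v x <= p (x + t *: v) - t * p v.
Proof. by move=> t0; apply: ge_inf => //; exists t. Qed.

Lemma slide_ge x c :
  (forall t, 0 <= t -> c <= p (x + t *: v) - t * p v) -> c <= slide p v x.
Proof.
move=> H; apply: lb_le_inf; last by move=> _ [t t0 <-]; exact: H.
by exists (p (x + 0 *: v) - 0 * p v), 0 => /=.
Qed.

Lemma slide_le_self x : slide p v x <= p x.
Proof. by have := slide_le x (lexx 0); rewrite scale0r mul0r addr0 subr0. Qed.

Lemma slide_sublinear : sublinear (slide p v).
Proof.
split=> [x y|].
  rewrite -lerBlDr; apply: slide_ge => s s0.
  rewrite lerBlDr [_ + slide _ _ y]addrC -lerBlDr.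
  apply: slide_ge => t t0; rewrite lerBlDr [leRHS]addrACA -opprD -mulrDl.
  (* Parameters [s] for [x] and [t] for [y] are matched by [t + s] for [x + y]. *)
  rewrite (le_trans (slide_le _ (addr_ge0 t0 s0)))// lerD2r.
  by rewrite scalerDl [x + y]addrC addrACA pP.1.
apply: sublinear_homog_le => [|t x t0].
  apply/eqP; rewrite eq_le; apply/andP; split.
    by rewrite (le_trans (slide_le_self _))// sublinear0.
  by apply: slide_ge => t t0; rewrite add0r pP.2// subrr.
rewrite -ler_pdivrMl//; apply: slide_ge => s s0; rewrite ler_pdivrMl//.
rewrite (le_trans (slide_le _ (mulr_ge0 (ltW t0) s0)))//.
by rewrite -scalerA -scalerDr pP.2 ?(ltW t0)// mulrBr mulrA.
Qed.

End Slide.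

(** Zorn's lemma for the reversed pointwise order on the sublinear functionals below [p]. *)
Lemma minimal_sublinear p : sublinear p -> exists q, [/\ sublinear q,
  forall x, q x <= p x &
  forall q', sublinear q' -> (forall x, q' x <= q x) -> q' = q].
Proof.
move=> pP; pose S := {q | sublinear q /\ forall x, q x <= p x}.
pose Q (q q' : S) := `[< forall x, sval q' x <= sval q x >].
have pp : sublinear p /\ forall x, p x <= p x by [].
have [| | | |[q [qP qp]] qmin] := @Zorn S Q.
- by move=> q; apply/asboolP.
- move=> q r s /asboolP qr /asboolP rs; apply/asboolP => x.
  exact: le_trans (rs x) (qr x).
- move=> [q qP] [r rP] /asboolP qr /asboolP rq; apply/eq_exist/funext => x.
  by apply/eqP; rewrite eq_le qr rq.
- move=> A Atot; have [->|/set0P[a Aa]] := eqVneq A set0.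
    by exists (exist _ p pp).
  have [||_ _ [r Ar <-] [s As <-]|i iP iA] := @inf_sublinear (sval @` A) p.
  + by exists (sval a), a.
  + by move=> _ [[r rP] _ <-].
  + by have [/asboolP|/asboolP] := Atot _ _ Ar As; [right|left].
  have ip x : i x <= p x.
    have Aa' : (sval @` A) (sval a) by exists a.
    exact: le_trans (iA _ x Aa') ((svalP a).2 x).
  exists (exist _ i (conj iP ip)) => s As; apply/asboolP => x /=.
  by apply: iA; exists s.
exists q; split=> // q' q'P q'q.
have q'p x : q' x <= p x := le_trans (q'q x) (qp x).
apply: (congr1 sval (qmin (exist _ q' (conj q'P q'p)) _)); exact/asboolP.
Qed.

(* A minimal sublinear functional [q] equals [slide q v] for every [v], which
   yields [q x + q v <= q (x + v)]; starting from [slide p v] instead of [p]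
   forces the value [p v] at [v]. *)
Theorem hahn_banach_point p v : sublinear p ->
  exists l : V -> R^o, [/\ linear l, forall x, l x <= p x & l v = p v].
Proof.
move=> pP.
have [q [qP qp qmin]] := minimal_sublinear (slide_sublinear v pP).
have qD x y : q (x + y) = q x + q y.
  apply/eqP; rewrite eq_le qP.1/= -lerBrDr.
  have := slide_le y qP x ler01; rewrite scale1r mul1r.
  by rewrite (qmin _ (slide_sublinear y qP) (slide_le_self y qP)).
have q0 := sublinear0 qP.
have qN x : q (- x) = - q x.
  by apply/eqP; rewrite -addr_eq0 -qD addNr q0.
exists q; split.
- move=> a x y; rewrite qD; congr (_ + _).
  have [a0|a0] := leP 0 a; first by rewrite qP.2.
  by rewrite -[a in LHS]opprK scaleNr qN qP.2 ?oppr_ge0 ?(ltW a0)// mulNr opprK.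
- by move=> x; rewrite (le_trans (qp x))// slide_le_self.
apply/eqP; rewrite eq_le; apply/andP; split.
  by rewrite (le_trans (qp v))// slide_le_self.
(* The term [t = 1] of [slide p v (- v)] is [p 0 - p v], whence [- q v <= - p v]. *)
have := le_trans (qp (- v)) (slide_le v pP (- v) ler01).
by rewrite scale1r mul1r addNr sublinear0// sub0r qN lerN2.
Qed.

End HahnBanach.

(** * Minkowski functionals *)

Section Gauge.
Context {R : realType}.

Lemma convex_set_comb (V : lmodType R) (A : set V) x y (a b : R) :
  convex_set A -> 0 <= a -> 0 <= b -> a + b = 1 -> A x -> A y ->
  A (a *: x + b *: y).
Proof.
move=> Ac a0 b0 ab Ax Ay.
have a1 : a <= 1 by rewrite -ab lerDl.
have -> : b = 1 - a by rewrite -ab [a + b]addrC addrK.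
exact: set_mem (Ac x y (Itv01 a0 a1) (mem_set Ax) (mem_set Ay)).
Qed.

Context {X : tvsType R}.

(** A convex neighbourhood given by local convexity is intersected with its reflection through 0. *)
Lemma nbhs0_convex_sym (U : set X) : nbhs 0 U -> exists2 V : set X,
  nbhs 0 V & [/\ forall a b x y, 0 <= a -> 0 <= b -> a + b = 1 ->
                V x -> V y -> V (a *: x + b *: y),
              forall x, V x -> V (- x) & V `<=` U].
Proof.
have [B Bc [Bo Bb]] := @locally_convex R X.
move=> /(Bb 0)[W [BW W0] WU].
have nW : nbhs 0 W by apply: open_nbhs_nbhs; split=> //; exact: Bo.
have Wc := Bc W (mem_set BW).
exists [set x | W x /\ W (- x)].
  apply: filterI => //; apply: (@opp_continuous X 0).
  by rewrite /= oppr0.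
split=> [a b x y a0 b0 ab [Wx WNx] [Wy WNy]|x [Wx WNx]|x [/WU]//].
  by rewrite /= opprD -!scalerN; split; exact: convex_set_comb.
by rewrite /= opprK.
Qed.

Section Def.
Variable V : set X.
Hypotheses (V0 : nbhs 0 V)
  (Vc : forall a b x y, 0 <= a -> 0 <= b -> a + b = 1 ->
     V x -> V y -> V (a *: x + b *: y))
  (VN : forall x, V x -> V (- x)).

Definition gauge_set (x : X) : set R := [set t | 0 < t /\ V (t^-1 *: x)].
Definition gauge (x : X) : R := inf (gauge_set x).

Let V00 : V 0. Proof. exact: nbhs_singleton. Qed.

Let VZ a x : 0 <= a -> a <= 1 -> V x -> V (a *: x).
Proof.
move=> a0 a1 Vx; rewrite -[a *: x]addr0 -(scaler0 _ (1 - a)).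
by apply: Vc; rewrite ?subr_ge0// addrC subrK.
Qed.

(** [V] is absorbing: by continuity of scaling at [(0, x)], small multiples of [x] lie in [V]. *)
Let gauge_set_ex x : gauge_set x !=set0.
Proof.
have := @scale_continuous R X (0, x); rewrite /continuous_at/= scale0r.
move=> /(_ V V0)[[A B] /= [A0 Bx] AB].
have [e /= e0 eA] := (nbhs_ballP _ _).1 A0.
exists (e / 2)^-1; split; first by rewrite invr_gt0 divr_gt0.
rewrite invrK; apply: (AB (e / 2, x)); split; last exact: nbhs_singleton.
apply: eA; rewrite -ball_normE/= sub0r normrN gtr0_norm ?divr_gt0//.
by rewrite ltr_pdivrMr// ltr_pMr// ltr1n.
Qed.

Let gauge_set_lb x : has_lbound (gauge_set x).
Proof. by exists 0 => t [/ltW]. Qed.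

Let gauge_le x t : gauge_set x t -> gauge x <= t.
Proof. by move=> xt; apply: ge_inf. Qed.

(** [V] is star-shaped about 0, so [gauge_set x] is upward closed. *)
Let gauge_lt x r : gauge x < r -> gauge_set x r.
Proof.
move=> /(inf_lt (gauge_set_ex x))[t [t0 Vx] tr].
have r0 := lt_trans t0 tr; split=> //.
rewrite (_ : r^-1 *: x = (t / r) *: (t^-1 *: x)).
  apply: VZ => //; first by rewrite divr_ge0// ltW.
  by rewrite ler_pdivrMr// mul1r ltW.
by rewrite scalerA mulrAC divff ?gt_eqF// mul1r.
Qed.

Lemma gauge_lt1 x : gauge x < 1 -> V x.
Proof. by move=> /gauge_lt[_]; rewrite invr1 scale1r. Qed.

Let gauge_ge0 x : 0 <= gauge x.
Proof. by apply: lb_le_inf => // t [/ltW]. Qed.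

Let gaugeN x : gauge (- x) = gauge x.
Proof.
congr inf; apply/seteqP; split=> t [t0 Vt]; split=> //.
  by rewrite -[x]opprK scalerN; exact: VN.
by rewrite scalerN; exact: VN.
Qed.

Let gaugeD x y : gauge (x + y) <= gauge x + gauge y.
Proof.
apply/ler_addgt0Pr => e e0; have e20 : 0 < e / 2 by rewrite divr_gt0.
have [s0 Vs] : gauge_set x (gauge x + e / 2) by apply: gauge_lt; rewrite ltrDl.
have [t0 Vt] : gauge_set y (gauge y + e / 2) by apply: gauge_lt; rewrite ltrDl.
rewrite [e in leRHS]splitr addrACA.
move: (gauge x + _) (gauge y + _) s0 t0 Vs Vt => s t s0 t0 Vs Vt.
have st0 : 0 < s + t by rewrite addr_gt0.
apply: gauge_le; split=> //.
(* Convexity with weights [s / (s + t)] and [t / (s + t)]. *)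
rewrite (_ : _ *: (x + y) =
    (s / (s + t)) *: (s^-1 *: x) + (t / (s + t)) *: (t^-1 *: y)).
  apply: Vc => //; rewrite ?divr_ge0 ?ltW//.
  by rewrite -mulrDl divff// gt_eqF.
by rewrite !scalerA ![_ / (s + t)]mulrC !mulfK ?gt_eqF// scalerDr.
Qed.

Let gaugeZ (a : R) x : gauge (a *: x) = `|a| * gauge x.
Proof.
have Z t y : 0 <= t -> gauge (t *: y) = t * gauge y.
  apply: sublinear_homog_le => [|{t y}t y t0].
    apply/eqP; rewrite eq_le gauge_ge0 andbT; apply/ler_addgt0Pr => e e0.
    by rewrite add0r gauge_le//; split=> //; rewrite scaler0.
  rewrite -ler_pdivrMl//; apply: lb_le_inf => // s [s0 Vs].
  rewrite ler_pdivrMl//; apply: gauge_le; split; first exact: mulr_gt0.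
  by rewrite scalerA invfM mulrAC mulVf ?gt_eqF// mul1r.
have [a0|a0] := leP 0 a; first by rewrite Z// ger0_norm.
by rewrite -gaugeN -scaleNr Z ?oppr_ge0 ?(ltW a0)// ltr0_norm.
Qed.

Lemma gauge_seminorm : is_seminorm gauge.
Proof. by []. Qed.

Lemma gauge_continuous : continuous gauge.
Proof.
move=> x; apply/cvgrPdist_lt => e e0.
have e20 : 0 < e / 2 by rewrite divr_gt0.
(* On the neighbourhood [x + (e / 2) V] the displacement has gauge at most [e / 2]; the reverse
   triangle inequality concludes. *)
have := nbhsT x (nbhs0Z (lt0r_neq0 e20) V0).
apply: filterS => _ [_ [v Vv <-] <-].
have ve : gauge ((e / 2) *: v) < e.
  apply: (@le_lt_trans _ _ (e / 2)).
    apply: gauge_le; split=> //.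
    by rewrite scalerA mulVf ?gt_eqF// scale1r.
  by rewrite ltr_pdivrMr// ltr_pMr// ltr1n.
apply: le_lt_trans ve; rewrite ler_distl lerBlDr gaugeD/=.
rewrite -[in leLHS](addrK ((e / 2) *: v) x) -(gaugeN (_ *: v)).
exact: gaugeD.
Qed.

End Def.

(** Unit balls of continuous seminorms form a neighbourhood base at 0; local convexity enters the
    extension below in this form. *)
Lemma nbhs0_seminorm (U : set X) : nbhs 0 U ->
  exists p : X -> R,
    [/\ is_seminorm p, continuous p & forall x, p x < 1 -> U x].
Proof.
move=> /nbhs0_convex_sym[V V0 [Vc VN VU]]; exists (gauge V); split.
- exact: gauge_seminorm.
- exact: gauge_continuous.
- by move=> x /(gauge_lt1 V0 Vc)/VU.
Qed.

End Gauge.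

(** * Extension to the Lipschitz-free space *)

Lemma seminorm_sublinear {R : realType} {V : lmodType R} (p : V -> R) :
  is_seminorm p -> sublinear p.
Proof. by move=> [_ pD pZ]; split=> // t x t0; rewrite pZ ger0_norm. Qed.

Lemma seminormN {R : realType} {V : lmodType R} (p : V -> R) x :
  is_seminorm p -> p (- x) = p x.
Proof. by move=> [_ _ pZ]; rewrite -scaleN1r pZ normrN1 mul1r. Qed.

Lemma seminorm_triangle {R : realType} {V : lmodType R} (p : V -> R) y x z :
  is_seminorm p -> p (x - z) <= p (x - y) + p (y - z).
Proof. by move=> [_ pD _]; rewrite (le_trans _ (pD _ _))// addrA subrK. Qed.

Lemma lspan_min {R : realType} {V : lmodType R} (A B : set V) :
  B 0 -> (forall a u v, B u -> B v -> B (a *: u + v)) -> A `<=` B ->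
  lspan A `<=` B.
Proof.
move=> B0 BP AB _ [n [a [x [Ax ->]]]].
by elim/big_rec: _ => // i v _ Bv; apply: BP => //; exact/AB.
Qed.

(** Every neighbourhood of 0 contains some unit ball [p x < 1], hence [z], so 0 and [z] cannot be
    separated. *)
Lemma hausdorff_seminorm_eq0 {R : realType} {X : tvsType R} (z : X) :
  hausdorff_space X ->
  (forall p : X -> R, is_seminorm p -> continuous p -> p z = 0) -> z = 0.
Proof.
move=> hX pz; apply/esym/hX => A B /nbhs0_seminorm[p [ps pc pA]] Bz.
by exists z; split; [apply: pA; rewrite pz|exact: nbhs_singleton].
Qed.

(** Radius 1 suffices because unit balls already form a base at 0, which translation carries to
    [h y]. *)
Lemma continuous_seminorm {R : realType} {Y : topologicalType} {X : tvsType R}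
    (h : Y -> X) :
  (forall (p : X -> R) y, is_seminorm p -> continuous p ->
     \forall y' \near y, p (h y' - h y) < 1) ->
  continuous h.
Proof.
move=> hp y U Uy.
have : nbhs (0 : X) [set x | U (h y + x)].
  apply: (@continuous_comp _ _ _ (fun x => (h y, x)) (fun z => z.1 + z.2)).
  - by apply: cvg_pair; [exact: cvg_cst|exact: cvg_id].
  - exact: add_continuous.
  - by rewrite /= addr0.
move=> /nbhs0_seminorm[p [ps pc pU]].
apply: filterS (hp p y ps pc) => y' /pU; rewrite /= addrC subrK.
exact.
Qed.

Lemma near_dist_lt {R : realType} {V : normedModType R} (m u : V) (e : R) :
  `|m - u| < e -> \forall m' \near m, `|m' - u| < e.
Proof.
apply: (@cvgr_norm_lt _ _ _ _ _ (fun m' => m' - u)).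
by apply: cvgB; [exact: cvg_id|exact: cvg_cst].
Qed.

Section Extension.
Context {R : realType} {M : metricType R} (o : M) {X : tvsType R} (j : M -> X).

(* The graph of the linear extension of [delta x |-> j x] to the span of the
   evaluations; that it is functional follows from [ext_graph_bound]. *)
Definition ext_graph : set (lip_free o * X) :=
  lspan (range (fun x => (delta o x, j x))).

Lemma ext_graph_linear a z w : ext_graph z -> ext_graph w ->
  ext_graph (a *: z + w).
Proof. exact: lspan_submod. Qed.

Lemma ext_graphB z w : ext_graph z -> ext_graph w -> ext_graph (z - w).
Proof.
move=> Gz Gw; have := ext_graph_linear (-1) Gw Gz.
by rewrite scaleN1r addrC.
Qed.

Lemma ext_graph_delta u : lspan (range (delta o)) u ->
  exists y, ext_graph (u, y).
Proof.
move: u; apply: lspan_min => [|a u v [y Gu] [z Gv]|_ [x _ <-]].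
- by exists 0, 0%N, (fun=> 0), (fun=> 0); split; [case|rewrite big_ord0].
- by exists (a *: y + z); exact: (ext_graph_linear a Gu Gv).
- by exists (j x); apply: lspan_sub; exists x.
Qed.

Lemma ext_graph_range y : lspan (range j) y -> exists u, ext_graph (u, y).
Proof.
move: y; apply: lspan_min => [|a u v [y Gu] [z Gv]|_ [x _ <-]].
- by exists 0, 0%N, (fun=> 0), (fun=> 0); split; [case|rewrite big_ord0].
- by exists (a *: y + z); exact: (ext_graph_linear a Gu Gv).
- by exists (delta o x); apply: lspan_sub; exists x.
Qed.

Lemma ext_graph_approx m e : 0 < e ->
  exists u y, ext_graph (u, y) /\ `|m - u| < e.
Proof.
move=> e0; have [u /ext_graph_delta[y Gu] mu] := lip_free_approx m e0.
by exists u, y.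
Qed.

Hypothesis jo : j o = 0.

(* Testing [y] with a functional [l <= p] such that [l y = p y] pairs [u] with
   the Lipschitz function [l \o j], whose constant is at most [c]. *)
Lemma ext_graph_bound (p : X -> R) c u y : is_seminorm p -> 0 <= c ->
  (forall x x', p (j x - j x') <= c * mdist x x') ->
  ext_graph (u, y) -> p y <= c * `|u|.
Proof.
move=> ps c0 pj Guy.
have [l [lin lp ly]] := hahn_banach_point y (seminorm_sublinear ps).
have lB a b : l (a - b) = l a - l b.
  by rewrite addrC -scaleN1r lin scaleN1r addrC.
have l0 : l 0 = 0 by rewrite -(subrr 0) lB subrr.
(* The one-sided bound [l <= p] controls the absolute value because [p] is even. *)
have lj x x' : `|l (j x) - l (j x')| <= c * mdist x x'.
  rewrite -lB (le_trans _ (pj x x'))// ler_norml lp andbT lerNl.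
  by rewrite -(seminormN _ ps) -sub0r -l0 -lB sub0r.
have gP : (l \o j : M -> R^o) \in lip0_pred o.
  apply/lip0_predP; split; first by exists c.
  by rewrite /= jo.
pose g : lip0 o := Lip0 gP.
have ug : l y = lip_free_dual u g.
  (* Both sides are linear in the pair and agree on the generators [(delta o x, j x)], with value
     [l (j x)]. *)
  suff /(_ _ Guy) : ext_graph `<=` [set z | l z.2 = lip_free_dual z.1 g] by [].
  apply: lspan_min.
  - exact: l0.
  - by move=> a [u1 y1] [u2 y2] /= E1 E2; rewrite lin E1 E2.
  - by move=> _ [x _ <-].
rewrite -ly ug (le_trans (ler_norm _))// (le_trans (dual_normP _ _))//.
by rewrite mulrC ler_wpM2r ?dual_norm_ge0//; exact: lip0_norm_le.
Qed.

Hypotheses (hX : hausdorff_space X) (cX : tvs_complete X).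
Hypothesis jL : seminorm_lipschitz j.

(** The image under the graph of the neighbourhood filter of [m]; its limit will be [phi m]. *)
Definition ext_filter (m : lip_free o) : set_system X :=
  filter_from [set e : R | 0 < e]
    (fun e => [set y | exists2 u, ext_graph (u, y) & `|m - u| < e]).

Lemma ext_filter_proper m : ProperFilter (ext_filter m).
Proof.
apply: filter_from_proper => [|e e0]; last first.
  by have [u [y [Gu mu]]] := ext_graph_approx m e0; exists y, u.
apply: filter_from_filter; first by exists 1 => /=.
move=> e e' /= e0 e'0; exists (Num.min e e'); first by rewrite lt_min e0.
by move=> y [u Gu]; rewrite lt_min => /andP[ue ue']; split; exists u.
Qed.

Lemma ext_filter_cauchy m : tvs_cauchy (ext_filter m).
Proof.
move=> U /nbhs0_seminorm[p [ps pc pU]]; have [c c0 pj] := jL ps pc.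
(* Two points this close to [m] are less than [c^-1] apart, so [ext_graph_bound] gives a value below
   1. *)
have e0 : 0 < (2 * c)^-1 by rewrite invr_gt0 mulr_gt0.
exists [set y | exists2 u, ext_graph (u, y) & `|m - u| < (2 * c)^-1].
  by exists (2 * c)^-1.
move=> y y' [u Gu mu] [u' Gu' mu']; apply: pU.
rewrite (le_lt_trans (ext_graph_bound ps (ltW c0) pj (ext_graphB Gu Gu')))//.
rewrite -ltr_pdivlMl// mulr1 (le_lt_trans (ler_distD m _ _))//.
rewrite distrC (lt_le_trans (ltrD mu mu'))// -mulr2n -[_ *+ 2]mulr_natl.
by rewrite invfM mulrA divff// mul1r.
Qed.

(** The bound of [ext_graph_bound] passes to the limit along [ext_filter m]. The resulting estimate
    both identifies [phi] on the graph and yields its continuity. *)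
Lemma ext_exists : exists phi : lip_free o -> X,
  forall (p : X -> R) c, is_seminorm p -> continuous p -> 0 <= c ->
  (forall x x', p (j x - j x') <= c * mdist x x') ->
  forall m u y, ext_graph (u, y) -> p (phi m - y) <= c * `|m - u|.
Proof.
have /choice[phi phiP] m : exists x : X, ext_filter m --> x.
  exact: cX (ext_filter_proper m) (@ext_filter_cauchy m).
exists phi => p c ps pc c0 pj m u y Gu; apply/ler_addgt0Pr => e e0.
have c1 : 0 < c + 1 by rewrite ltr_pwDr.
have [d /= d0 dU] : ext_filter m [set z | p (phi m - z) < e / 2].
  apply: phiP.
  have pcm : {for phi m, continuous (fun z => p (phi m - z))}.
    apply: continuous_comp; last exact: pc.
    apply: (@continuous_comp _ _ _ (fun z => (phi m, z)) (fun z => z.1 - z.2)).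
      by apply: cvg_pair; [exact: cvg_cst|exact: cvg_id].
    exact: sub_continuous.
  have /cvgrPdist_lt/(_ (e / 2)) := pcm; rewrite divr_gt0// => /(_ isT).
  rewrite subrr (sublinear0 (seminorm_sublinear ps)).
  by apply: filterS => z; rewrite sub0r normrN;
    apply: le_lt_trans; exact: ler_norm.
(* Radius [d] makes [p (phi m - y') < e / 2]; the other makes [c * |m - u'|] at most [e / 2], with
   [c + 1] as divisor since [c] may be 0. *)
have d1 : 0 < Num.min d (e / 2 / (c + 1)) by rewrite lt_min d0/= !divr_gt0.
have [u' [y' [Gu']]] := ext_graph_approx m d1.
rewrite lt_min ltr_pdivlMr// => /andP[u'd u'e].
have /= py' := dU y' (ex_intro2 _ _ u' Gu' u'd).
rewrite (le_trans (seminorm_triangle y' _ _ ps))//.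
have := ext_graph_bound ps c0 pj (ext_graphB Gu' Gu) => /= pyy.
rewrite [e in leRHS]splitr addrCA lerD ?(ltW py')// (le_trans pyy)//.
apply: (le_trans (ler_wpM2l c0 (ler_distD m u' u))).
rewrite (distrC u' m) mulrDr [leLHS]addrC lerD2l.
apply: le_trans (ltW u'e); rewrite mulrC.
by apply: ler_wpM2l; rewrite ?normr_ge0// lerDl.
Qed.

End Extension.

(** * Continuity, dense range and intertwining *)

Theorem theorem2p6 (R : realType) (M : metricType R) (o : M) (f : M -> M)
    (X : tvsType R) (T : X -> X) (j : M -> X) :
  is_lipschitz f -> f o = o ->
  hausdorff_space X -> tvs_complete X ->
  is_linearization o f T j ->
  seminorm_lipschitz j ->
  quasi_conjugate T (lip_free_op o f).
Proof.
move=> fL fo hX cX [[Tlin Tc] _ Tj jo jdense] jL.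
have [Slin Sc Sdelta] := lip_free_opP fL fo.
set S := lip_free_op o f in Slin Sc Sdelta *.
have [phi phiP] := ext_exists jo cX jL.
(* At [m = u] the estimate reads [p (phi u - y) <= 0] for every continuous seminorm [p]. *)
have phi_graph (u : lip_free o) y : ext_graph j (u, y) -> phi u = y.
  move=> Gu; apply/eqP; rewrite -subr_eq0; apply/eqP.
  apply: hausdorff_seminorm_eq0 => // p ps pc; have [c c0 pj] := jL p ps pc.
  apply/eqP; rewrite eq_le; apply/andP; split; last by case: ps.
  by have := phiP p c ps pc (ltW c0) pj u u y Gu; rewrite subrr normr0 mulr0.
have phi_cont : continuous phi.
  apply: continuous_seminorm => p m ps pc; have [c c0 pj] := jL p ps pc.
  (* One [u] within [(4 * c)^-1] of [m] and of all nearby [m'] bounds [p (phi m' - phi m)] by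
     [1 / 2]. *)
  have e0 : 0 < (4 * c)^-1 by rewrite invr_gt0 mulr_gt0.
  have [u [y [Gu mu]]] := ext_graph_approx j m e0.
  apply: filterS (near_dist_lt mu) => m' mu'.
  rewrite (le_lt_trans (seminorm_triangle y _ _ ps))//.
  have := phiP p c ps pc (ltW c0) pj m u y Gu.
  have := phiP p c ps pc (ltW c0) pj m' u y Gu.
  rewrite -(seminormN (phi m - y) ps) opprB => H1 H2.
  rewrite (le_lt_trans (lerD H1 H2))// -mulrDr -ltr_pdivlMl// mulr1.
  rewrite (lt_trans (ltrD mu' mu))// -mulr2n -[_ *+ 2]mulr_natl invfM mulrA.
  by rewrite gtr_pMl ?invr_gt0// ltr_pdivrMr// mul1r ltr_nat.
(* By linearity it suffices to look at generators: [(delta o x, j x)] goes to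
   [(delta o (f x), j (f x))]. *)
have graphTS (u : lip_free o) y : ext_graph j (u, y) -> ext_graph j (S u, T y).
  have T0 : T 0 = 0.
    by have := Tlin (-1) 0 0; rewrite !scaleN1r !addNr.
  have S0 : S 0 = 0.
    by have := Slin (-1) 0 0; rewrite !scaleN1r !addNr.
  move=> Gu; suff /(_ _ Gu) :
    ext_graph j `<=` [set z | ext_graph j (S z.1, T z.2)] by [].
  apply: lspan_min => /= [|a [u1 y1] [u2 y2] /= G1 G2|_ [x _ <-]].
  - rewrite S0 T0; exists 0%N, (fun=> 0), (fun=> 0).
    by split; [case|rewrite big_ord0].
  - by rewrite Slin Tlin; exact: (ext_graph_linear a G1 G2).
  - apply: lspan_sub; exists (f x) => //=.
    by rewrite Sdelta -[T (j x)]/((T \o j) x) Tj.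
exists phi; split=> //.
  move=> O O0 Oo; have [y [Oy /(ext_graph_range o)[u Gu]]] := jdense O O0 Oo.
  by exists y; split=> //; exists u => //; exact: phi_graph.
(* Both composites are continuous and agree at graph points [u] arbitrarily near [m], so in a
   Hausdorff space they agree at [m]. *)
apply/funext => m /=; apply: hX => A B nA nB.
have nm : nbhs m ((T \o phi) @^-1` A `&` (phi \o S) @^-1` B).
  apply: filterI.
    by apply: (continuous_comp (phi_cont m) (@Tc (phi m))).
  by apply: (continuous_comp (@Sc m) (phi_cont (S m))).
have [e /= e0 eAB] := (nbhs_ballP _ _).1 nm.
have [u [y [Gu mu]]] := ext_graph_approx j m e0.
have [/= Au Bu] : ((T \o phi) @^-1` A `&` (phi \o S) @^-1` B) u.
  by apply: eAB; rewrite -ball_normE.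
exists (T (phi u)); split=> //.
by rewrite (phi_graph _ _ Gu) -(phi_graph _ _ (graphTS _ _ Gu)).
Qed.
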